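(* Let $\mathcal{C}$ be a rigid C$^*$-tensor category and let $(\mathcal{M},m)$ be an injective pointed C$^*$-$\mathcal{C}$-module category. For any $U\in\mathcal{C}$ and any direct summand $m'$ of $m\triangleleft U$, the pointed C$^*$-$\mathcal{C}$-module category $(\mathcal{M},m')$ is also injective.
   Context: $\mathcal{C}$ is strict with simple unit; C$^*$-categories have finite direct sums and subobjects. A right C$^*$-$\mathcal{C}$-module category is a C$^*$-category $\mathcal{M}$ with a (strict) right action $*$-bifunctor $\triangleleft\colon\mathcal{M}\times\mathcal{C}\to\mathcal{M}$. It is pointed when an object $m$ is fixed, notation $(\mathcal{M},m)$. A multiplier $\Theta\colon(\mathcal{M},m)\to(\mathcal{M}',m')$ is a family of linear maps $\Theta_{X,Y}\colon\mathcal{M}(m\triangleleft X,m\triangleleft Y)\to\mathcal{M}'(m'\triangleleft X,m'\triangleleft Y)$, $X,Y\in\mathcal{C}$, with $$\Theta_{X\otimes U,Z\otimes U}\bigl(((\mathrm{id}_m\triangleleft\phi)f(\mathrm{id}_m\triangleleft\psi))\triangleleft\mathrm{id}_U\bigr)=((\mathrm{id}_{m'}\triangleleft\phi)\Theta_{Y,W}(f)(\mathrm{id}_{m'}\triangleleft\psi))\triangleleft\mathrm{id}_U$$ for all $\psi\in\mathcal{C}(X,Y)$, $\phi\in\mathcal{C}(W,Z)$, $f\in\mathcal{M}(m\triangleleft Y,m\triangleleft W)$, $U\in\mathcal{C}$. It is ucp if every $\Theta_{X,X}$ is unital completely positive, and completely isometric if all $\Theta_{X,Y}$ are (matrix norms: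 $M_n(\mathcal{M}(X,Y))=\mathcal{M}(X^{\oplus n},Y^{\oplus n})$). $(\mathcal{M},m)$ is injective if for any ucp multiplier $\Phi\colon(\mathcal{N},n)\to(\mathcal{M},m)$ and any completely isometric ucp multiplier $\Psi\colon(\mathcal{N},n)\to(\mathcal{N}',n')$ of pointed C$^*$-$\mathcal{C}$-module categories there is a ucp multiplier $\tilde\Phi\colon(\mathcal{N}',n')\to(\mathcal{M},m)$ with $\tilde\Phi\Psi=\Phi$. *)

(* Defs.v *)
From HB Require Import structures.
From mathcomp Require Import all_boot all_order all_algebra.
From mathcomp Require Import all_classical all_reals all_analysis.
From mathcomp Require Import complex.

Set Implicit Arguments.
Unset Strict Implicit.
Unset Printing Implicit Defensive.

Import Order.TTheory GRing.Theory Num.Theory.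
Import numFieldNormedType.Exports.

Local Open Scope ring_scope.
Local Open Scope complex_scope.

Declare Scope cstar_scope.
Delimit Scope cstar_scope with cstar.

Reserved Notation "g \oc f" (at level 40, left associativity).
Reserved Notation "f ^\adj" (at level 1, left associativity, format "f ^\adj").

(* Complex scalars are [R[i]] for [R : realType]; the norm of a
   [completeNormedModType R[i]] takes its (nonnegative) values in [R[i]]. *)
Record cstarCat (R : realType) := CstarCat {
  ob :> Type;
  hom : ob -> ob -> completeNormedModType R[i];
  idm : forall X, hom X X;
  hcomp : forall X Y Z, hom Y Z -> hom X Y -> hom X Z
    where "g \oc f" := (hcomp g f);
  adj : forall X Y, hom X Y -> hom Y X
    where "f ^\adj" := (adj f);

  hcompA : forall X Y Z W (h : hom Z W) (g : hom Y Z) (f : hom X Y),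
    h \oc (g \oc f) = (h \oc g) \oc f;
  hcomp1m : forall X Y (f : hom X Y), idm Y \oc f = f;
  hcompm1 : forall X Y (f : hom X Y), f \oc idm X = f;
  hcomp_linearl : forall X Y Z (a : R[i]) (g g' : hom Y Z) (f : hom X Y),
    (a *: g + g') \oc f = a *: (g \oc f) + g' \oc f;
  hcomp_linearr : forall X Y Z (a : R[i]) (g : hom Y Z) (f f' : hom X Y),
    g \oc (a *: f + f') = a *: (g \oc f) + g \oc f';

  adj_antilinear : forall X Y (a : R[i]) (f g : hom X Y),
    (a *: f + g)^\adj = Num.conj a *: f^\adj + g^\adj;
  adjK : forall X Y (f : hom X Y), f^\adj^\adj = f;
  adj_hcomp : forall X Y Z (g : hom Y Z) (f : hom X Y),
    (g \oc f)^\adj = f^\adj \oc g^\adj;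

  norm_hcomp : forall X Y Z (g : hom Y Z) (f : hom X Y),
    `|g \oc f| <= `|g| * `|f|;
  cstar_norm : forall X Y (f : hom X Y), `|f^\adj \oc f| = `|f| ^+ 2;
  (* [f^* f] is a positive element of the C*-algebra [End X] *)
  adj_hcomp_pos : forall X Y (f : hom X Y),
    exists g : hom X X, f^\adj \oc f = g^\adj \oc g
}.

Arguments idm {R c} X.

Notation "g \oc f" := (hcomp g f) : cstar_scope.
Notation "f ^\adj" := (adj f) : cstar_scope.
Local Open Scope cstar_scope.

Section CstarCatTheory.
Variables (R : realType) (C : cstarCat R).

Definition isometry (X Y : C) (v : hom X Y) := v^\adj \oc v = idm X.

Definition projection (X : C) (p : hom X X) := p^\adj = p /\ p \oc p = p.

Definition is_positive (X : C) (f : hom X X) :=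
  exists g : hom X X, f = g^\adj \oc g.

Definition is_direct_sum (n : nat) (X : 'I_n -> C) (S : C)
    (w : forall i, hom (X i) S) :=
  [/\ forall i, isometry (w i),
      forall i j, i != j -> (w i)^\adj \oc w j = 0 &
      \sum_(i < n) w i \oc (w i)^\adj = idm S].

(* For [n = 0] this provides a zero object. *)
Definition has_direct_sums :=
  forall (n : nat) (X : 'I_n -> C),
    exists (S : C) (w : forall i, hom (X i) S), is_direct_sum w.

Definition has_subobjects :=
  forall (X : C) (p : hom X X), projection p ->
    exists (Y : C) (v : hom Y X), isometry v /\ v \oc v^\adj = p.

Definition direct_summand (Y S : C) :=
  exists (Z : C) (v : hom Y S) (w : hom Z S),
    [/\ isometry v, isometry w, v^\adj \oc w = 0 &
        v \oc v^\adj + w \oc w^\adj = idm S].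

(* The morphism [S -> T] with matrix [a] in [M_n(hom X Y)], for direct sums
   [S] and [T] of [n] copies of [X] and of [Y] with embeddings [v] and [w]. *)
Definition mx_mor (n : nat) (X Y S T : C)
    (v : 'I_n -> hom X S) (w : 'I_n -> hom Y T)
    (a : 'I_n -> 'I_n -> hom X Y) : hom S T :=
  \sum_(i < n) \sum_(j < n) w i \oc a i j \oc (v j)^\adj.

(* Transport along equalities of objects, needed because the tensor products
   and actions below are strict. *)
Definition castm (X X' Y Y' : C) (eX : X = X') (eY : Y = Y')
    (f : hom X Y) : hom X' Y' :=
  match eX in _ = x, eY in _ = y return hom x y with
  | erefl, erefl => f
  end.

End CstarCatTheory.

Record cstarTensorCat (R : realType) := CstarTensorCat {
  tcat :> cstarCat R;
  tcat_direct_sums : has_direct_sums tcat;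
  tcat_subobjects : has_subobjects tcat;

  tunit : tcat;
  tens : tcat -> tcat -> tcat;
  tensm : forall X X' Y Y' : tcat,
    hom X X' -> hom Y Y' -> hom (tens X Y) (tens X' Y');

  tensm_id : forall X Y : tcat, tensm (idm X) (idm Y) = idm (tens X Y);
  tensm_hcomp : forall (X X' X'' Y Y' Y'' : tcat)
      (f' : hom X' X'') (f : hom X X') (g' : hom Y' Y'') (g : hom Y Y'),
    tensm (f' \oc f) (g' \oc g) = tensm f' g' \oc tensm f g;
  tensm_linearl : forall (X X' Y Y' : tcat) (a : R[i])
      (f f' : hom X X') (g : hom Y Y'),
    tensm (a *: f + f') g = a *: tensm f g + tensm f' g;
  tensm_linearr : forall (X X' Y Y' : tcat) (a : R[i])
      (f : hom X X') (g g' : hom Y Y'),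
    tensm f (a *: g + g') = a *: tensm f g + tensm f g';
  tensm_adj : forall (X X' Y Y' : tcat) (f : hom X X') (g : hom Y Y'),
    (tensm f g)^\adj = tensm f^\adj g^\adj;

  tensA : forall X Y Z : tcat, tens (tens X Y) Z = tens X (tens Y Z);
  tensX1 : forall X : tcat, tens X tunit = X;
  tens1X : forall X : tcat, tens tunit X = X;
  tensmA : forall (X X' Y Y' Z Z' : tcat)
      (f : hom X X') (g : hom Y Y') (h : hom Z Z'),
    castm (tensA X Y Z) (tensA X' Y' Z') (tensm (tensm f g) h)
      = tensm f (tensm g h);
  tensm1r : forall (X X' : tcat) (f : hom X X'),
    castm (tensX1 X) (tensX1 X') (tensm f (idm tunit)) = f;
  tensm1l : forall (X X' : tcat) (f : hom X X'),
    castm (tens1X X) (tens1X X') (tensm (idm tunit) f) = f;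

  tunit_neq0 : idm tunit != 0;
  tunit_simple : forall f : hom tunit tunit,
    exists a : R[i], f = a *: idm tunit
}.

Arguments tunit {R c}.

(* [(rb^* (x) id_U) (id_U (x) r) = id_U] and
   [(r^* (x) id_V) (id_V (x) rb) = id_V] *)
Definition conjugate_equations (R : realType) (C : cstarTensorCat R)
    (U V : C) (r : hom tunit (tens V U)) (rb : hom tunit (tens U V)) :=
  castm erefl (tens1X U) (tensm rb^\adj (idm U))
    \oc castm (tensX1 U) (esym (tensA U V U)) (tensm (idm U) r) = idm U
  /\
  castm erefl (tens1X V) (tensm r^\adj (idm V))
    \oc castm (tensX1 V) (esym (tensA V U V)) (tensm (idm V) rb) = idm V.

Definition rigid (R : realType) (C : cstarTensorCat R) :=
  forall U : C, exists (V : C)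
    (r : hom tunit (tens V U)) (rb : hom tunit (tens U V)),
    conjugate_equations r rb.

Record cstarModCat (R : realType) (C : cstarTensorCat R) := CstarModCat {
  mcat :> cstarCat R;
  mcat_direct_sums : has_direct_sums mcat;
  mcat_subobjects : has_subobjects mcat;

  act : mcat -> C -> mcat;
  actm : forall (m m' : mcat) (X X' : C),
    hom m m' -> hom X X' -> hom (act m X) (act m' X');

  actm_id : forall (m : mcat) (X : C), actm (idm m) (idm X) = idm (act m X);
  actm_hcomp : forall (m m' m'' : mcat) (X X' X'' : C)
      (f' : hom m' m'') (f : hom m m') (g' : hom X' X'') (g : hom X X'),
    actm (f' \oc f) (g' \oc g) = actm f' g' \oc actm f g;
  actm_linearl : forall (m m' : mcat) (X X' : C) (a : R[i])
      (f f' : hom m m') (g : hom X X'),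
    actm (a *: f + f') g = a *: actm f g + actm f' g;
  actm_linearr : forall (m m' : mcat) (X X' : C) (a : R[i])
      (f : hom m m') (g g' : hom X X'),
    actm f (a *: g + g') = a *: actm f g + actm f g';
  actm_adj : forall (m m' : mcat) (X X' : C) (f : hom m m') (g : hom X X'),
    (actm f g)^\adj = actm f^\adj g^\adj;

  actA : forall (m : mcat) (X Y : C), act (act m X) Y = act m (tens X Y);
  act1 : forall m : mcat, act m tunit = m;
  actmA : forall (m m' : mcat) (X X' Y Y' : C)
      (f : hom m m') (g : hom X X') (h : hom Y Y'),
    castm (actA m X Y) (actA m' X' Y') (actm (actm f g) h)
      = actm f (tensm g h);
  actm1 : forall (m m' : mcat) (f : hom m m'),
    castm (act1 m) (act1 m') (actm f (idm tunit)) = f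
}.

Section Multipliers.
Variables (R : realType) (C : cstarTensorCat R).

(* [f <| id_U], viewed as a morphism between [m <| (X (x) U)] and
   [m <| (Y (x) U)] through strictness of the action *)
Definition act_idr (M : cstarModCat C) (m : M) (X Y U : C)
    (f : hom (act m X) (act m Y)) :
    hom (act m (tens X U)) (act m (tens Y U)) :=
  castm (actA m X U) (actA m Y U) (actm f (idm U)).

Record multiplier (M : cstarModCat C) (m : M) (M' : cstarModCat C) (m' : M') :=
  Multiplier {
  mult_map :> forall X Y : C,
    {linear hom (act m X) (act m Y) -> hom (act m' X) (act m' Y)};
  mult_mapP : forall (X Y Z W U : C) (psi : hom X Y) (phi : hom W Z)
      (f : hom (act m Y) (act m W)),
    mult_map (tens X U) (tens Z U)
        (act_idr U (actm (idm m) phi \oc f \oc actm (idm m) psi))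
    = act_idr U
        (actm (idm m') phi \oc mult_map Y W f \oc actm (idm m') psi)
}.

Section Properties.
Variables (M M' : cstarModCat C) (m : M) (m' : M') (T : multiplier m m').

Definition mult_unital :=
  forall X : C, T X X (idm (act m X)) = idm (act m' X).

(* Positivity in [M_n(End Z)] is positivity in the C*-algebra [End S], for a
   direct sum [S] of [n] copies of [Z]. *)
Definition mult_cp :=
  forall (X : C) (n : nat)
      (S : M) (v : 'I_n -> hom (act m X) S)
      (S' : M') (v' : 'I_n -> hom (act m' X) S')
      (a : 'I_n -> 'I_n -> hom (act m X) (act m X)),
    is_direct_sum v -> is_direct_sum v' ->
    is_positive (mx_mor v v a) ->
    is_positive (mx_mor v' v' (fun i j => T X X (a i j))).

Definition mult_ucp := mult_unital /\ mult_cp.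

Definition completely_isometric :=
  forall (X Y : C) (n : nat)
      (S : M) (v : 'I_n -> hom (act m X) S)
      (Q : M) (w : 'I_n -> hom (act m Y) Q)
      (S' : M') (v' : 'I_n -> hom (act m' X) S')
      (Q' : M') (w' : 'I_n -> hom (act m' Y) Q')
      (a : 'I_n -> 'I_n -> hom (act m X) (act m Y)),
    is_direct_sum v -> is_direct_sum w ->
    is_direct_sum v' -> is_direct_sum w' ->
    `|mx_mor v' w' (fun i j => T X Y (a i j))| = `|mx_mor v w a|.

End Properties.

Definition injective_pointed (M : cstarModCat C) (m : M) :=
  forall (N : cstarModCat C) (n : N) (N' : cstarModCat C) (n' : N')
      (Phi : multiplier n m) (Psi : multiplier n n'),
    mult_ucp Phi -> mult_ucp Psi -> completely_isometric Psi ->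
    exists Phi' : multiplier n' m,
      mult_ucp Phi' /\
      forall (X Y : C) (f : hom (act n X) (act n Y)),
        Phi' X Y (Psi X Y f) = Phi X Y f.

End Multipliers.

(* Main.v *)
Require Import Defs.
From HB Require Import structures.
From mathcomp Require Import all_boot all_order all_algebra.
From mathcomp Require Import all_classical all_reals all_analysis.
From mathcomp Require Import complex.
Import Defs.

Set Implicit Arguments.
Unset Strict Implicit.
Unset Printing Implicit Defensive.

Import Order.TTheory GRing.Theory Num.Theory.
Import numFieldNormedType.Exports.

Local Open Scope classical_set_scope.
Local Open Scope ring_scope.
Local Open Scope complex_scope.
Local Open Scope cstar_scope.

(** Injectivity is inherited by [m <| U] and by direct summands, for two
    separate reasons.

    Action ([injective_act]). Choose a conjugate [V] of [U] with solutions
    [r : 1 -> V (x) U], [rb : 1 -> U (x) V] of the conjugate equations, scaled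
    so that [rb] is an isometry. A multiplier
    [Phi : (N, n) -> (M, m <| U)] gives, by Frobenius reciprocity, a multiplier
    into [(M, m)]: evaluate [Phi] on morphisms between the objects
    [n <| (V (x) X)], which is a multiplier [(N, n <| V) -> (M, m <| U <| V)],
    and compress by the isometry [m -> m <| U <| V] coming from [rb]. The same
    shift of [Psi] is completely isometric, so injectivity of [(M, m)] yields an
    extension [theta : (N', n' <| V) -> (M, m)]. Going back, let [Phi' f] be
    the value on [s f s^\adj] of [theta] shifted by [U], where
    [s : n' -> n' <| V <| U] comes from [r]. Multipliers commute with
    conjugation by [s] ([shift_mult_unit]), so [Phi' (Psi f)] is [Phi f]
    conjugated by [(rb^* (x) id_U) (id_U (x) r)], which is the identity of [U]
    ([act_conjugate]). Since [Phi] and [Psi] are unital, so is [Phi'].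

    Summands ([injective_summand]). Let [p = q + z] be an orthogonal
    decomposition with isometries [v : q -> p] and [w : z -> p], and let [Phi]
    be ucp with values in [(M, q)]. The multiplier [f |-> v Phi(f) v^*] into
    [(M, p)] is completely positive but not unital, and completing it would take a
    ucp multiplier from [(N, n)] to [(M, z)]. The remedy is to enlarge the
    source instead: on the product module category [N x M] pointed by [(n, z)],
    [(f, g) |-> v Phi(f) v^* + w g w^*] is ucp. Its extension along [Psi x id],
    restricted to the pairs [(f, 0)] and compressed by [v], extends [Phi].

    Both constructions are compositions of a few operations on multipliers
    (composition, sum, compression, shift, pairing), each of which preserves
    complete positivity. Strictness of the tensor product and of the action
    makes associativity an equality of objects; the resulting transports are
    handled by an equality of morphisms up to equality of their end points
    ([heq]). *)

(** * Completeness of products of normed modules *)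

Section ProductCompleteness.

HB.instance Definition _ (T U : puniformType) := Pointed.on (T * U)%type.

Lemma prod_complete (T U : completeType) (F : set_system (T * U)) :
  ProperFilter F -> cauchy F -> cvg F.
Proof.
move=> FF Fc.
have c1 : cauchy (fst @ F).
  move=> A entA; rewrite near_simpl -near2E near_map2; apply: Fc.
  exists (A, setT); first by split => //; exact: entourageT.
  by move=> [[a c] [b d]] [/= Aac _]; exists ((a, b), (c, d)).
have c2 : cauchy (snd @ F).
  move=> A entA; rewrite near_simpl -near2E near_map2; apply: Fc.
  exists (setT, A); first by split => //; exact: entourageT.
  by move=> [[a c] [b d]] [/= _ Abd]; exists ((a, b), (c, d)).
have l1 : fst @ F --> lim (fst @ F) by apply: (@cauchy_cvg T).
have l2 : snd @ F --> lim (snd @ F) by apply: (@cauchy_cvg U).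
apply/cvg_ex; exists (lim (fst @ F), lim (snd @ F)).
apply: cvg_trans (cvg_pair l1 l2).
move=> A FA; rewrite (_ : A = (fun x => (x.1, x.2)) @^-1` A) //.
by apply/funext => -[].
Qed.

HB.instance Definition _ (K : numFieldType) (T U : completeNormedModType K) :=
  Uniform_isComplete.Build (T * U)%type (@prod_complete T U).

End ProductCompleteness.

(** * C*-categories: linearity, positivity and direct sums *)

(** Maps proved linear, packaged so that the generic lemmas on linear maps
    apply to composition, tensor products, actions and transports. *)
Definition linear_of (R : realType) (V W : lmodType R[i]) (f : V -> W)
    (fl : linear f) : {linear V -> W} :=
  HB.pack f (GRing.isLinear.Build R[i] V W *:%R f fl).

Section CategoryBasics.
Variables (R : realType) (C : cstarCat R).

Let lcomp (X Y Z : C) (f : hom X Y) : {linear hom Y Z -> hom X Z} :=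
  linear_of (fun a g g' => hcomp_linearl a g g' f).

Let rcomp (X Y Z : C) (g : hom Y Z) : {linear hom X Y -> hom X Z} :=
  linear_of (fun a f f' => hcomp_linearr a g f f').

Lemma hcompDl (X Y Z : C) (g g' : hom Y Z) (f : hom X Y) :
  (g + g') \oc f = g \oc f + g' \oc f.
Proof. exact: (linearD (lcomp Z f)). Qed.

Lemma hcompDr (X Y Z : C) (g : hom Y Z) (f f' : hom X Y) :
  g \oc (f + f') = g \oc f + g \oc f'.
Proof. exact: (linearD (rcomp X g)). Qed.

Lemma hcomp0m (X Y Z : C) (f : hom X Y) : (0 : hom Y Z) \oc f = 0.
Proof. exact: (linear0 (lcomp Z f)). Qed.

Lemma hcompm0 (X Y Z : C) (g : hom Y Z) : g \oc (0 : hom X Y) = 0.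
Proof. exact: (linear0 (rcomp X g)). Qed.

Lemma hcompZl (X Y Z : C) (a : R[i]) (g : hom Y Z) (f : hom X Y) :
  (a *: g) \oc f = a *: (g \oc f).
Proof. exact: (linearZ_LR (lcomp Z f)). Qed.

Lemma hcompZr (X Y Z : C) (a : R[i]) (g : hom Y Z) (f : hom X Y) :
  g \oc (a *: f) = a *: (g \oc f).
Proof. exact: (linearZ_LR (rcomp X g)). Qed.

Lemma hcomp_suml (I : finType) (X Y Z : C) (g : I -> hom Y Z) (f : hom X Y) :
  (\sum_i g i) \oc f = \sum_i g i \oc f.
Proof. exact: (linear_sum (lcomp Z f)). Qed.

Lemma hcomp_sumr (I : finType) (X Y Z : C) (g : hom Y Z) (f : I -> hom X Y) :
  g \oc (\sum_i f i) = \sum_i g \oc f i.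
Proof. exact: (linear_sum (rcomp X g)). Qed.

Lemma adjD (X Y : C) (f g : hom X Y) : (f + g)^\adj = f^\adj + g^\adj.
Proof. by have := adj_antilinear 1 f g; rewrite conjC1 !scale1r. Qed.

Lemma adj0 (X Y : C) : (0 : hom X Y)^\adj = 0.
Proof. by apply: (addrI (0 : hom X Y)^\adj); rewrite -adjD !addr0. Qed.

Lemma adj_sum (I : finType) (X Y : C) (f : I -> hom X Y) :
  (\sum_i f i)^\adj = \sum_i (f i)^\adj.
Proof. exact: (big_morph _ (@adjD X Y) (adj0 X Y)). Qed.

Lemma adj_scale (X Y : C) (a : R[i]) (f : hom X Y) :
  (a *: f)^\adj = Num.conj a *: f^\adj.
Proof. by have := adj_antilinear a f 0; rewrite adj0 !addr0. Qed.

Lemma adj_id (X : C) : (idm X)^\adj = idm X.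
Proof.
have e : (idm X)^\adj \oc idm X = (idm X)^\adj by rewrite hcompm1.
by rewrite -[RHS]adjK -e adj_hcomp adjK e.
Qed.

Lemma isometry_id (X : C) : isometry (idm X).
Proof. by rewrite /isometry adj_id hcomp1m. Qed.

Lemma norm_idm_le1 (X : C) : `|idm X| <= 1.
Proof.
have : `|idm X| * (`|idm X| - 1) = 0.
  by rewrite mulrBr mulr1 -expr2 -cstar_norm isometry_id subrr.
move/eqP; rewrite mulf_eq0 subr_eq0 => /orP[]/eqP-> //; exact: ler01.
Qed.

Lemma norm_isometry_le1 (X Y : C) (v : hom X Y) : isometry v -> `|v| <= 1.
Proof.
by move=> vI; rewrite -(@expr_le1 _ 2) // -cstar_norm vI norm_idm_le1.
Qed.

Lemma adj_hcomp_is_positive (X Y : C) (f : hom X Y) : is_positive (f^\adj \oc f).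
Proof. by have [g ->] := adj_hcomp_pos f; exists g. Qed.

Lemma is_positive_conj (X Y : C) (f : hom X X) (t : hom Y X) :
  is_positive f -> is_positive (t^\adj \oc f \oc t).
Proof.
move=> [g ->]; have := adj_hcomp_is_positive (g \oc t).
by rewrite adj_hcomp !hcompA.
Qed.

Lemma is_positive0 (X : C) : is_positive (0 : hom X X).
Proof. by exists 0; rewrite hcompm0. Qed.

(** A sum of two squares is the square of the column that they form. *)
Lemma is_positiveD (X : C) (f g : hom X X) : has_direct_sums C ->
  is_positive f -> is_positive g -> is_positive (f + g).
Proof.
move=> dsC [f' ->] [g' ->].
have [S [w [wI wO _]]] := dsC 2 (fun=> X).
have := adj_hcomp_is_positive (w 0 \oc f' + w 1 \oc g').
rewrite adjD !adj_hcomp !hcompDl !hcompDr -!hcompA.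
rewrite !(hcompA (w _)^\adj) !wI !wO // !hcomp1m !hcomp0m !hcompm0.
by rewrite addr0 add0r.
Qed.

Section DirectSums.
Variable n : nat.

Lemma direct_sum_adj (X S : C) (v : 'I_n -> hom X S) : is_direct_sum v ->
  forall i j, (v i)^\adj \oc v j = if i == j then idm X else 0.
Proof. by move=> [vI vO _] i j; case: eqVneq => [->|/vO->] //; exact: vI. Qed.

(** Multiplying by such diagonal morphisms changes the direct sums with respect
    to which a matrix of morphisms is written, and at the same time composes all
    its entries with [t]. *)
Definition diag_mor (X Y S T : C) (v : 'I_n -> hom X S) (w : 'I_n -> hom Y T)
    (t : hom X Y) : hom S T := \sum_i w i \oc t \oc (v i)^\adj.

Lemma adj_diag_mor (X Y S T : C) (v : 'I_n -> hom X S) (w : 'I_n -> hom Y T)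
    (t : hom X Y) :
  (diag_mor v w t)^\adj = diag_mor w v t^\adj.
Proof.
rewrite /diag_mor adj_sum; apply: eq_bigr => i _.
by rewrite !adj_hcomp adjK hcompA.
Qed.

Lemma mx_mor_diagr (X' X Y S' S T : C) (v' : 'I_n -> hom X' S')
    (v : 'I_n -> hom X S) (w : 'I_n -> hom Y T) a (t : hom X' X) :
  is_direct_sum v ->
  mx_mor v w a \oc diag_mor v' v t = mx_mor v' w (fun i j => a i j \oc t).
Proof.
move=> dv; rewrite /mx_mor hcomp_suml; apply: eq_bigr => i _.
rewrite hcomp_suml; apply: eq_bigr => j _.
rewrite /diag_mor hcomp_sumr (bigD1 j) //= big1 => [|k kj].
  by rewrite addr0 !hcompA -(hcompA _ _ (v j)) direct_sum_adj // eqxx hcompm1.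
rewrite !hcompA -(hcompA _ _ (v k)) direct_sum_adj // eq_sym (negPf kj).
by rewrite hcompm0 !hcomp0m.
Qed.

Lemma mx_mor_diagl (X Y Y' S T T' : C) (v : 'I_n -> hom X S)
    (w : 'I_n -> hom Y T) (w' : 'I_n -> hom Y' T') a (t : hom Y Y') :
  is_direct_sum w ->
  diag_mor w w' t \oc mx_mor v w a = mx_mor v w' (fun i j => t \oc a i j).
Proof.
move=> dw; rewrite /mx_mor hcomp_sumr.
transitivity (\sum_i \sum_j
    diag_mor w w' t \oc w i \oc (a i j \oc (v j)^\adj)).
  apply: eq_bigr => i _; rewrite hcomp_sumr; apply: eq_bigr => j _.
  by rewrite !hcompA.
apply: eq_bigr => i _; apply: eq_bigr => j _.
rewrite /diag_mor hcomp_suml (bigD1 i) //= big1 => [|k ki].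
  by rewrite addr0 -(hcompA _ _ (w i)) direct_sum_adj // eqxx hcompm1 !hcompA.
by rewrite -(hcompA _ _ (w i)) direct_sum_adj // (negPf ki) hcompm0.
Qed.

Lemma diag_mor_isometry (X Y S T : C) (v : 'I_n -> hom X S)
    (w : 'I_n -> hom Y T) (t : hom X Y) :
  is_direct_sum v -> is_direct_sum w -> isometry t ->
  isometry (diag_mor v w t).
Proof.
move=> [_ _ vT] dw tI; rewrite /isometry adj_diag_mor /diag_mor hcomp_suml.
rewrite -vT; apply: eq_bigr => i _; rewrite hcomp_sumr (bigD1 i) //= big1.
  rewrite addr0 !hcompA -(hcompA _ _ (w i)) direct_sum_adj // eqxx hcompm1.
  by rewrite -(hcompA _ _ t) tI hcompm1.
move=> k ki; rewrite !hcompA -(hcompA _ _ (w k)) direct_sum_adj // eq_sym.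
by rewrite (negPf ki) hcompm0 !hcomp0m.
Qed.

Lemma mx_morD (X Y S T : C) (v : 'I_n -> hom X S) (w : 'I_n -> hom Y T) a b :
  mx_mor v w (fun i j => a i j + b i j) = mx_mor v w a + mx_mor v w b.
Proof.
rewrite /mx_mor -big_split; apply: eq_bigr => i _ /=.
by rewrite -big_split; apply: eq_bigr => j _ /=; rewrite hcompDr hcompDl.
Qed.

Lemma mx_mor0 (X Y S T : C) (v : 'I_n -> hom X S) (w : 'I_n -> hom Y T) :
  mx_mor v w (fun _ _ => 0) = 0.
Proof.
rewrite /mx_mor big1 // => i _; rewrite big1 // => j _.
by rewrite hcompm0 hcomp0m.
Qed.

Lemma eq_mx_mor (X Y S T : C) (v : 'I_n -> hom X S) (w : 'I_n -> hom Y T) a b :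
  (forall i j, a i j = b i j) -> mx_mor v w a = mx_mor v w b.
Proof. by move=> ab; apply: eq_bigr => i _; apply: eq_bigr => j _; rewrite ab. Qed.

(** Two direct sums of the same objects are related by the unitary [diag_mor] of
    an identity, hence the norm of a matrix of morphisms does not depend on the
    choice of the sums; exchanging the two sums gives the equality below. *)
Lemma norm_mx_mor_le (X Y S S' T T' : C) (v : 'I_n -> hom X S)
    (w : 'I_n -> hom Y T) (v' : 'I_n -> hom X S') (w' : 'I_n -> hom Y T') a :
  is_direct_sum v -> is_direct_sum w ->
  is_direct_sum v' -> is_direct_sum w' ->
  `|mx_mor v' w' a| <= `|mx_mor v w a|.
Proof.
move=> dv dw dv' dw'.
have -> : mx_mor v' w' a =
    diag_mor w w' (idm Y) \oc mx_mor v w a \oc diag_mor v' v (idm X).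
  rewrite mx_mor_diagl // mx_mor_diagr //.
  by apply: eq_mx_mor => i j; rewrite hcompm1 hcomp1m.
have nw : `|diag_mor w w' (idm Y)| <= 1.
  by apply/norm_isometry_le1/diag_mor_isometry => //; exact: isometry_id.
have nv : `|diag_mor v' v (idm X)| <= 1.
  by apply/norm_isometry_le1/diag_mor_isometry => //; exact: isometry_id.
apply: le_trans (norm_hcomp _ _) _; apply: le_trans (ler_piMr _ nv) _ => //.
by apply: le_trans (norm_hcomp _ _) _; apply: ler_piMl.
Qed.

End DirectSums.

Lemma norm_mx_mor_eq (n : nat) (X Y S S' T T' : C) (v : 'I_n -> hom X S)
    (w : 'I_n -> hom Y T) (v' : 'I_n -> hom X S') (w' : 'I_n -> hom Y T') a :
  is_direct_sum v -> is_direct_sum w ->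
  is_direct_sum v' -> is_direct_sum w' ->
  `|mx_mor v' w' a| = `|mx_mor v w a|.
Proof. by move=> *; apply/eqP; rewrite eq_le !norm_mx_mor_le. Qed.

End CategoryBasics.

(** * Products of C*-categories and of module categories *)

Section ProductCategory.
Variables (R : realType) (A B : cstarCat R).

Definition prod_hom (X Y : A * B) : completeNormedModType R[i] :=
  (hom X.1 Y.1 * hom X.2 Y.2)%type.

Lemma prod_norm_max (V W : completeNormedModType R[i]) (x : V * W) :
  `|x| = Num.max `|x.1| `|x.2|.
Proof. by []. Qed.

Lemma max_norm_sqr (x y : R[i]) : 0 <= x -> 0 <= y ->
  Num.max (x ^+ 2) (y ^+ 2) = Num.max x y ^+ 2.
Proof.
move=> x0 y0; have /orP[xy|yx] := real_leVge (ger0_real x0) (ger0_real y0).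
  by rewrite !max_r // ler_pXn2r.
by rewrite !max_l // ler_pXn2r.
Qed.

Lemma max_norm_ge (x y : R[i]) : 0 <= x -> 0 <= y ->
  x <= Num.max x y /\ y <= Num.max x y.
Proof.
move=> x0 y0; have /orP[xy|yx] := real_leVge (ger0_real x0) (ger0_real y0).
  by rewrite max_r.
by rewrite max_l.
Qed.

Lemma max_norm_mul (x y z t x' y' : R[i]) :
  0 <= x -> 0 <= y -> 0 <= z -> 0 <= t -> x' <= x * z -> y' <= y * t ->
  Num.max x' y' <= Num.max x y * Num.max z t.
Proof.
move=> x0 y0 z0 t0 x'le y'le.
have [xm ym] := max_norm_ge x0 y0; have [zm tm] := max_norm_ge z0 t0.
rewrite maxEle; case: ifP => _.
  by apply: le_trans y'le _; exact: ler_pM.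
by apply: le_trans x'le _; exact: ler_pM.
Qed.

Definition prodCat : cstarCat R.
Proof.
refine (@CstarCat R (A * B)%type prod_hom
  (fun X => (idm X.1, idm X.2))
  (fun X Y Z g f => (g.1 \oc f.1, g.2 \oc f.2))
  (fun X Y f => (f.1^\adj, f.2^\adj)) _ _ _ _ _ _ _ _ _ _ _).
- by move=> *; rewrite /= !hcompA.
- by move=> X Y [f g]; rewrite /= !hcomp1m.
- by move=> X Y [f g]; rewrite /= !hcompm1.
- by move=> X Y Z a g g' f; congr pair; exact: hcomp_linearl.
- by move=> X Y Z a g f f'; congr pair; exact: hcomp_linearr.
- by move=> X Y a f g; congr pair; exact: adj_antilinear.
- by move=> X Y [f g]; rewrite /= !adjK.
- by move=> *; rewrite /= !adj_hcomp.
- by move=> X Y Z g f; apply: max_norm_mul => //; exact: norm_hcomp.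
- by move=> X Y f; rewrite !prod_norm_max /= !cstar_norm max_norm_sqr.
- move=> X Y f; have [g1 e1] := adj_hcomp_pos f.1.
  by have [g2 e2] := adj_hcomp_pos f.2; exists (g1, g2); rewrite e1 e2.
Defined.

Definition pairm (X Y : prodCat) (f : hom X.1 Y.1) (g : hom X.2 Y.2) :
  hom X Y := (f, g).

Lemma sum_pair (I : finType) (X Y : prodCat) (f : I -> hom X Y) :
  \sum_i f i = pairm (\sum_i (f i).1) (\sum_i (f i).2).
Proof.
apply/esym/(big_ind3 (fun u v w => pairm u v = w)) => //.
- by move=> u1 v1 w1 u2 v2 w2 <- <-.
- by move=> i _; rewrite /pairm; case: (f i).
Qed.

Lemma direct_sum_pair n (X : 'I_n -> prodCat) (S : prodCat)
    (w : forall i, hom (X i) S) :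
  is_direct_sum w <->
  is_direct_sum (fun i => (w i).1) /\ is_direct_sum (fun i => (w i).2).
Proof.
split.
  move=> [wI wO wT]; split; split.
  - by move=> i; case: (wI i).
  - by move=> i j /wO[].
  - by move: wT; rewrite sum_pair => -[].
  - by move=> i; case: (wI i).
  - by move=> i j /wO[].
  - by move: wT; rewrite sum_pair => -[].
move=> [[I1 O1 T1] [I2 O2 T2]]; split.
- by move=> i; congr pair; [exact: I1|exact: I2].
- by move=> i j ij; congr pair; [exact: O1|exact: O2].
- by rewrite sum_pair; congr pair.
Qed.

Lemma prodCat_direct_sums : has_direct_sums A -> has_direct_sums B ->
  has_direct_sums prodCat.
Proof.
move=> dA dB n X; have [S [v dv]] := dA n (fun i => (X i).1).
have [T [w dw]] := dB n (fun i => (X i).2).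
by exists (S, T), (fun i => (v i, w i)); apply/direct_sum_pair.
Qed.

Lemma prodCat_subobjects : has_subobjects A -> has_subobjects B ->
  has_subobjects prodCat.
Proof.
move=> sA sB X [p q] [ps pp].
have [Y [v [vI vp]]] := sA X.1 p (conj (congr1 fst ps) (congr1 fst pp)).
have [Z [w [wI wq]]] := sB X.2 q (conj (congr1 snd ps) (congr1 snd pp)).
by exists (Y, Z), (v, w); split; congr pair.
Qed.

Lemma mx_mor_pair n (X Y S T : prodCat) (v : 'I_n -> hom X S)
    (w : 'I_n -> hom Y T) a :
  mx_mor v w a =
  pairm (mx_mor (fun i => (v i).1) (fun i => (w i).1) (fun i j => (a i j).1))
        (mx_mor (fun i => (v i).2) (fun i => (w i).2) (fun i j => (a i j).2)).
Proof.
rewrite {1}/mx_mor sum_pair; congr pairm;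
by apply: eq_bigr => i _; rewrite sum_pair.
Qed.

Lemma is_positive_pair (X : prodCat) (f : hom X X) :
  is_positive f <-> is_positive f.1 /\ is_positive f.2.
Proof.
split=> [[g ->]|[[g e1] [h e2]]]; first by split; [exists g.1|exists g.2].
by exists (pairm g h); rewrite [f]surjective_pairing e1 e2.
Qed.

Lemma castm_pair (X1 X1' Y1 Y1' : A) (X2 X2' Y2 Y2' : B)
    (eX : (X1, X2) = (X1', X2')) (eY : (Y1, Y2) = (Y1', Y2'))
    (e1 : X1 = X1') (e1' : Y1 = Y1') (e2 : X2 = X2') (e2' : Y2 = Y2')
    (f : hom X1 Y1) (g : hom X2 Y2) :
  castm (C := prodCat) eX eY (f, g) = (castm e1 e1' f, castm e2 e2' g).
Proof.
case: X1' / e1 eX => eX; case: X2' / e2 eX => eX.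
case: Y1' / e1' eY => eY; case: Y2' / e2' eY => eY.
by rewrite (Prop_irrelevance eX erefl) (Prop_irrelevance eY erefl).
Qed.

End ProductCategory.

Section ProductModule.
Variables (R : realType) (C : cstarTensorCat R) (M N : cstarModCat C).

Definition prodMod : cstarModCat C.
Proof.
refine (@CstarModCat R C (prodCat M N)
  (prodCat_direct_sums (@mcat_direct_sums _ _ M) (@mcat_direct_sums _ _ N))
  (prodCat_subobjects (@mcat_subobjects _ _ M) (@mcat_subobjects _ _ N))
  (fun m X => (act m.1 X, act m.2 X))
  (fun m m' X X' f g => (actm f.1 g, actm f.2 g)) _ _ _ _ _
  (fun m X Y => congr2 pair (actA m.1 X Y) (actA m.2 X Y))
  (fun m => etrans (congr2 pair (act1 m.1) (act1 m.2))
                   (esym (surjective_pairing m))) _ _).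
- by move=> m X; rewrite /= !actm_id.
- by move=> *; rewrite /= !actm_hcomp.
- by move=> m m' X X' a f f' g; congr pair; exact: actm_linearl.
- by move=> m m' X X' a f g g'; congr pair; exact: actm_linearr.
- by move=> *; rewrite /= !actm_adj.
- move=> m m' X X' Y Y' f g h.
  apply: etrans (castm_pair _ _ (actA m.1 X Y) (actA m'.1 X' Y')
    (actA m.2 X Y) (actA m'.2 X' Y') _ _) _.
  by rewrite /= !actmA.
- move=> [m1 m2] [m1' m2'] [f1 f2].
  apply: etrans (castm_pair _ _ (act1 m1) (act1 m1') (act1 m2) (act1 m2') _ _) _.
  by rewrite /= !actm1.
Defined.

End ProductModule.

(** * Equality of morphisms up to equality of objects *)

Section HeterogeneousEquality.
Variables (R : realType) (C : cstarCat R).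

(** Transports along different proofs of the same equality of objects agree, so
    this is an equivalence relation which restricts to equality on each space of
    morphisms and is respected by all the structure. *)
Definition heq (X Y X' Y' : C) (f : hom X Y) (g : hom X' Y') :=
  exists (eX : X = X') (eY : Y = Y'), castm eX eY f = g.

Lemma heq_refl (X Y : C) (f : hom X Y) : heq f f.
Proof. by exists erefl, erefl. Qed.

Lemma heq_sym (X Y X' Y' : C) (f : hom X Y) (g : hom X' Y') :
  heq f g -> heq g f.
Proof.
move=> [eX [eY]]; case: X' / eX g => g; case: Y' / eY g => g <-.
exact: heq_refl.
Qed.

Lemma heq_trans (X Y X' Y' X'' Y'' : C) (f : hom X Y) (g : hom X' Y')
    (h : hom X'' Y'') : heq f g -> heq g h -> heq f h.
Proof.
move=> [eX [eY]]; case: X' / eX g => g; case: Y' / eY g => g <-.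
by [].
Qed.

Lemma heq_eq (X Y : C) (f g : hom X Y) : heq f g -> f = g.
Proof.
move=> [eX [eY <-]].
by rewrite (Prop_irrelevance eX erefl) (Prop_irrelevance eY erefl).
Qed.

Lemma heq_castm (X Y X' Y' : C) (eX : X = X') (eY : Y = Y') (f : hom X Y) :
  heq (castm eX eY f) f.
Proof. by apply: heq_sym; exists eX, eY. Qed.

Lemma heq_hcomp (X Y Z X' Y' Z' : C) (g : hom Y Z) (f : hom X Y)
    (g' : hom Y' Z') (f' : hom X' Y') :
  heq g g' -> heq f f' -> heq (g \oc f) (g' \oc f').
Proof.
move=> [eY [eZ]]; case: Y' / eY g' f' => g' f'; case: Z' / eZ g' => g' <-.
move=> [eX [eY]]; case: X' / eX f' => f'.
rewrite (Prop_irrelevance eY erefl) => <-; exact: heq_refl.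
Qed.

Lemma heq_adj (X Y X' Y' : C) (f : hom X Y) (f' : hom X' Y') :
  heq f f' -> heq f^\adj f'^\adj.
Proof.
move=> [eX [eY]]; case: X' / eX f' => f'; case: Y' / eY f' => f' <-.
exact: heq_refl.
Qed.

Lemma heq_idm (X X' : C) : X = X' -> heq (idm X) (idm X').
Proof. by move=> ->; exact: heq_refl. Qed.

Lemma castm_id (X X' : C) (e e' : X = X') : castm e e' (idm X) = idm X'.
Proof. by apply: heq_eq; apply: heq_trans (heq_castm _ _ _) (heq_idm e). Qed.

Lemma castmK (X Y X' Y' : C) (eX : X = X') (eY : Y = Y') (f : hom X' Y') :
  castm eX eY (castm (esym eX) (esym eY) f) = f.
Proof. by case: X' / eX f => f; case: Y' / eY f. Qed.

Lemma castm_linear (X Y X' Y' : C) (eX : X = X') (eY : Y = Y') :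
  linear (castm eX eY).
Proof. by case: X' / eX; case: Y' / eY. Qed.

Lemma direct_sum_castm n (X X' S : C) (e : X = X') (v : 'I_n -> hom X S) :
  is_direct_sum v -> is_direct_sum (fun i => castm e erefl (v i)).
Proof. by case: X' / e. Qed.

Lemma mx_mor_castm n (X Y X' Y' S T : C) (eX : X = X') (eY : Y = Y')
    (v : 'I_n -> hom X S) (w : 'I_n -> hom Y T) a :
  mx_mor (fun i => castm eX erefl (v i)) (fun i => castm eY erefl (w i))
    (fun i j => castm eX eY (a i j)) = mx_mor v w a.
Proof. by case: X' / eX; case: Y' / eY. Qed.

End HeterogeneousEquality.

Section ModuleBasics.
Variables (R : realType) (C : cstarTensorCat R) (M : cstarModCat C).

Lemma heq_actm (a b a' b' : M) (Z W Z' W' : C) (f : hom a b) (f' : hom a' b')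
    (g : hom Z W) (g' : hom Z' W') :
  heq f f' -> heq g g' -> heq (actm f g) (actm f' g').
Proof.
move=> [eX [eY]]; case: a' / eX f' => f'; case: b' / eY f' => f' <-.
move=> [eZ [eW]]; case: Z' / eZ g' => g'; case: W' / eW g' => g' <-.
exact: heq_refl.
Qed.

Lemma heq_actmA (a b : M) (X Y Z W : C) (f : hom a b) (g : hom X Y)
    (h : hom Z W) : heq (actm (actm f g) h) (actm f (tensm g h)).
Proof. by exists (actA a X Z), (actA b Y W); exact: actmA. Qed.

Lemma heq_actm1 (a b : M) (f : hom a b) : heq (actm f (idm tunit)) f.
Proof. by exists (act1 a), (act1 b); exact: actm1. Qed.

Lemma actm_exchange (a b : M) (X Y : C) (f : hom a b) (g : hom X Y) :
  actm (idm b) g \oc actm f (idm X) = actm f (idm Y) \oc actm (idm a) g.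
Proof. by rewrite -!actm_hcomp !hcomp1m !hcompm1. Qed.

Lemma heq_act_idr (a : M) (X Y U : C) (f : hom (act a X) (act a Y)) :
  heq (act_idr U f) (actm f (idm U)).
Proof. exact: heq_castm. Qed.

Lemma act_idr_linear (a : M) (X Y U : C) : linear (@act_idr R C M a X Y U).
Proof. by move=> k f g; rewrite /act_idr actm_linearl castm_linear. Qed.

Lemma act_idr0 (a : M) (X Y U : C) :
  act_idr U (0 : hom (act a X) (act a Y)) = 0.
Proof. exact: (linear0 (linear_of (@act_idr_linear a X Y U))). Qed.

Lemma act_idrD (a : M) (X Y U : C) (f g : hom (act a X) (act a Y)) :
  act_idr U (f + g) = act_idr U f + act_idr U g.
Proof. exact: (linearD (linear_of (@act_idr_linear a X Y U))). Qed.

Lemma heq_act_idr1 (a : M) (X Y : C) (f : hom (act a X) (act a Y)) :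
  heq (act_idr tunit f) f.
Proof. exact: heq_trans (heq_act_idr _ _) (heq_actm1 _). Qed.

End ModuleBasics.

(** * Operations on multipliers *)

Section Multiplier.
Variables (R : realType) (C : cstarTensorCat R).

Lemma actm_hcomp_idr (M : cstarModCat C) (a b c : M) (U : C)
    (g : hom b c) (f : hom a b) :
  actm (g \oc f) (idm U) = actm g (idm U) \oc actm f (idm U).
Proof. by rewrite -actm_hcomp hcomp1m. Qed.

Lemma heq_actm_idm_idr (M : cstarModCat C) (a b : M) (X U : C) (f : hom a b) :
  heq (actm (actm f (idm X)) (idm U)) (actm f (idm (tens X U))).
Proof. by rewrite -tensm_id; exact: heq_actmA. Qed.

Section Laws.
Variables (M M' : cstarModCat C) (m : M) (m' : M') (T : multiplier m m').

Lemma heq_mult (X Y X' Y' : C) (f : hom (act m X) (act m Y))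
    (f' : hom (act m X') (act m Y')) :
  X = X' -> Y = Y' -> heq f f' -> heq (T X Y f) (T X' Y' f').
Proof.
move=> eX eY; case: X' / eX f' => f'; case: Y' / eY f' => f' /heq_eq ->.
exact: heq_refl.
Qed.

(** The defining identity of multipliers couples bimodularity with the action of
    an object [U]; taking [U] the unit object isolates the former, and identities
    for [phi] and [psi] the latter. *)
Lemma mult_bimod (X Y Z W : C) (psi : hom X Y) (phi : hom W Z)
    (f : hom (act m Y) (act m W)) :
  T X Z (actm (idm m) phi \oc f \oc actm (idm m) psi) =
  actm (idm m') phi \oc T Y W f \oc actm (idm m') psi.
Proof.
apply: heq_eq; apply: heq_trans (heq_act_idr1 _); rewrite -mult_mapP.
by apply: heq_mult; rewrite ?tensX1 //; apply/heq_sym/heq_act_idr1.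
Qed.

Lemma mult_idr (X Y U : C) (f : hom (act m X) (act m Y)) :
  T (tens X U) (tens Y U) (act_idr U f) = act_idr U (T X Y f).
Proof.
by have := mult_mapP T U (idm X) (idm Y) f; rewrite !actm_id !hcomp1m !hcompm1.
Qed.

End Laws.

Section Build.
Variables (M M' : cstarModCat C) (m : M) (m' : M').
Variable T : forall X Y : C,
  hom (act m X) (act m Y) -> hom (act m' X) (act m' Y).
Hypothesis linT : forall X Y, linear (@T X Y).
Hypothesis bimodT : forall (X Y Z W : C) (psi : hom X Y) (phi : hom W Z)
    (f : hom (act m Y) (act m W)),
  T (actm (idm m) phi \oc f \oc actm (idm m) psi) =
  actm (idm m') phi \oc T f \oc actm (idm m') psi.
Hypothesis idrT : forall (X Y U : C) (f : hom (act m X) (act m Y)),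
  T (act_idr U f) = act_idr U (T f).

Lemma build_multP (X Y Z W U : C) (psi : hom X Y) (phi : hom W Z)
    (f : hom (act m Y) (act m W)) :
  linear_of (@linT (tens X U) (tens Z U))
    (act_idr U (actm (idm m) phi \oc f \oc actm (idm m) psi)) =
  act_idr U (actm (idm m') phi \oc linear_of (@linT Y W) f
               \oc actm (idm m') psi).
Proof. by rewrite /= idrT bimodT. Qed.

Definition build_mult : multiplier m m' := Multiplier build_multP.

End Build.

Definition id_mult (M : cstarModCat C) (m : M) : multiplier m m.
Proof. exact: (@build_mult M M m m (fun X Y f => f)). Defined.

Definition zero_mult (M M' : cstarModCat C) (m : M) (m' : M') :
  multiplier m m'.
Proof.
refine (@build_mult M M' m m' (fun X Y f => 0) _ _ _).
- by move=> X Y k f g; rewrite scaler0 addr0.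
- by move=> *; rewrite hcompm0 hcomp0m.
- by move=> X Y U f; rewrite act_idr0.
Defined.

Definition comp_mult (M M' M'' : cstarModCat C) (m : M) (m' : M') (m'' : M'')
  (T' : multiplier m' m'') (T : multiplier m m') : multiplier m m''.
Proof.
refine (@build_mult M M'' m m'' (fun X Y f => T' X Y (T X Y f)) _ _ _).
- by move=> X Y k f g; rewrite !linearP.
- by move=> *; rewrite !mult_bimod.
- by move=> *; rewrite !mult_idr.
Defined.

Definition add_mult (M M' : cstarModCat C) (m : M) (m' : M')
  (S T : multiplier m m') : multiplier m m'.
Proof.
refine (@build_mult M M' m m' (fun X Y f => S X Y f + T X Y f) _ _ _).
- by move=> X Y k f g; rewrite !linearP scalerDr addrACA.
- by move=> *; rewrite !mult_bimod hcompDr hcompDl.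
- by move=> X Y U f; rewrite !mult_idr act_idrD.
Defined.

(** For an isometry [t] this is a compression, for the adjoint of an isometry it
    is the inclusion of a corner. *)
Definition conj_mult (M M' : cstarModCat C) (m : M) (m' m'' : M')
  (t : hom m'' m') (T : multiplier m m') : multiplier m m''.
Proof.
refine (@build_mult M M' m m''
  (fun X Y f => actm t^\adj (idm Y) \oc T X Y f \oc actm t (idm X)) _ _ _).
- by move=> X Y k f g; rewrite linearP hcomp_linearr hcomp_linearl.
- move=> X Y Z W psi phi f; rewrite mult_bimod -!hcompA actm_exchange !hcompA.
  by rewrite actm_exchange.
- move=> X Y U f; rewrite mult_idr; apply/heq_eq/heq_sym.
  apply: heq_trans (heq_act_idr _ _) _; rewrite !actm_hcomp_idr.
  apply: heq_hcomp; last exact: heq_actm_idm_idr.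
  apply: heq_hcomp; first exact: heq_actm_idm_idr.
  exact/heq_sym/heq_act_idr.
Defined.

(** A morphism between [m <| V <| X] and [m <| V <| Y] is one between
    [m <| (V (x) X)] and [m <| (V (x) Y)], where [T] can be applied: this moves
    the base points of a multiplier from [m], [m'] to [m <| V], [m' <| V]. *)
Definition shift_mult (M M' : cstarModCat C) (m : M) (m' : M') (V : C)
  (T : multiplier m m') : multiplier (act m V) (act m' V).
Proof.
refine (@build_mult M M' (act m V) (act m' V)
  (fun X Y f => castm (esym (actA m' V X)) (esym (actA m' V Y))
     (T (tens V X) (tens V Y) (castm (actA m V X) (actA m V Y) f))) _ _ _).
- by move=> X Y k f g; rewrite !(castm_linear, linearP).
- move=> X Y Z W psi phi f; apply: heq_eq; apply: heq_trans (heq_castm _ _ _) _.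
  (* acting on the right of [n <| V] by [p] is acting on [n] by [id_V (x) p] *)
  have E (N : cstarModCat C) (n : N) (A B : C) (p : hom A B) :
      heq (actm (idm (act n V)) p) (actm (idm n) (tensm (idm V) p)).
    by rewrite -actm_id; exact: heq_actmA.
  rewrite (_ : castm _ _ _ = actm (idm m) (tensm (idm V) phi) \oc
      castm (actA m V Y) (actA m V W) f \oc actm (idm m) (tensm (idm V) psi)).
    rewrite mult_bimod; apply: heq_hcomp; last exact/heq_sym/E.
    apply: heq_hcomp; first exact/heq_sym/E.
    exact/heq_sym/heq_castm.
  apply: heq_eq; apply: heq_trans (heq_castm _ _ _) _.
  apply: heq_hcomp; last exact: E.
  by apply: heq_hcomp; [exact: E | exact/heq_sym/heq_castm].
- move=> X Y U f; apply: heq_eq; apply: heq_trans (heq_castm _ _ _) _.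
  apply: heq_trans (heq_sym (heq_act_idr _ _)).
  apply: heq_trans (heq_actm (heq_sym (heq_castm _ _ _)) (heq_refl _)).
  apply: heq_trans (heq_act_idr _ _); rewrite -mult_idr.
  apply: heq_mult; rewrite ?tensA //; apply: heq_trans (heq_castm _ _ _) _.
  apply: heq_trans (heq_act_idr _ _) _; apply/heq_sym.
  apply: heq_trans (heq_act_idr _ _) _.
  by apply: heq_actm; [exact: heq_castm | exact: heq_refl].
Defined.

Definition fst_mult (M N : cstarModCat C) (m : M) (n : N) :
  multiplier ((m, n) : prodMod M N) m.
Proof.
refine (@build_mult (prodMod M N) M (m, n) m (fun X Y f => f.1) _ _ _) => //.
move=> X Y U f; rewrite /act_idr [X in castm _ _ X]surjective_pairing.
by rewrite (castm_pair _ _ (actA m X U) (actA m Y U) (actA n X U) (actA n Y U)).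
Defined.

Definition snd_mult (M N : cstarModCat C) (m : M) (n : N) :
  multiplier ((m, n) : prodMod M N) n.
Proof.
refine (@build_mult (prodMod M N) N (m, n) n (fun X Y f => f.2) _ _ _) => //.
move=> X Y U f; rewrite /act_idr [X in castm _ _ X]surjective_pairing.
by rewrite (castm_pair _ _ (actA m X U) (actA m Y U) (actA n X U) (actA n Y U)).
Defined.

Definition pair_mult (L M N : cstarModCat C) (l : L) (m : M) (n : N)
  (S : multiplier l m) (T : multiplier l n) :
  multiplier l ((m, n) : prodMod M N).
Proof.
refine (@build_mult L (prodMod M N) l (m, n)
  (fun X Y f => (S X Y f, T X Y f)) _ _ _).
- by move=> X Y k f g; rewrite !linearP.
- by move=> *; rewrite !mult_bimod.
- move=> X Y U f; rewrite !mult_idr; apply/esym.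
  exact: (castm_pair _ _ (actA m X U) (actA m Y U) (actA n X U) (actA n Y U)).
Defined.

End Multiplier.

(** * Complete positivity and complete isometry *)

(** With [t] an identity, this says that positivity of a matrix does not depend
    on the direct sum chosen to express it. *)
Lemma is_positive_mx_conj (R : realType) (C : cstarCat R) (n : nat)
    (X Y S T : C) (v : 'I_n -> hom X S) (w : 'I_n -> hom Y T)
    (a : 'I_n -> 'I_n -> hom X X) (t : hom Y X) :
  is_direct_sum v -> is_positive (mx_mor v v a) ->
  is_positive (mx_mor w w (fun i j => t^\adj \oc a i j \oc t)).
Proof.
move=> dv pa; rewrite -(mx_mor_diagr w w _ t dv) -(mx_mor_diagl v w a _ dv).
by rewrite -adj_diag_mor; exact: is_positive_conj.
Qed.

Section Positivity.
Variables (R : realType) (C : cstarTensorCat R).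

Section Operations.
Variables (M M' : cstarModCat C) (m : M) (m' : M').

Lemma conj_mult_cp (m'' : M') (t : hom m'' m') (T : multiplier m m') :
  mult_cp T -> mult_cp (conj_mult t T).
Proof.
move=> cpT X n S v S'' v'' a dv dv'' pa.
have [S' [v' dv']] := mcat_direct_sums (fun _ : 'I_n => act m' X).
have := is_positive_mx_conj v'' (actm t (idm X)) dv' (cpT _ _ _ _ _ _ _ dv dv' pa).
by rewrite actm_adj adj_id.
Qed.

Lemma id_mult_cp : mult_cp (id_mult m).
Proof.
move=> X n S v S' v' a dv dv' pa.
have -> : mx_mor v' v' a =
    mx_mor v' v' (fun i j => (idm _)^\adj \oc a i j \oc idm _).
  by apply: eq_mx_mor => i j; rewrite adj_id hcomp1m hcompm1.
exact: is_positive_mx_conj pa.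
Qed.

Lemma zero_mult_cp : mult_cp (zero_mult m m').
Proof. by move=> *; rewrite mx_mor0; exact: is_positive0. Qed.

Lemma add_mult_cp (S T : multiplier m m') :
  mult_cp S -> mult_cp T -> mult_cp (add_mult S T).
Proof.
move=> cpS cpT X n Q v Q' v' a dv dv' pa; rewrite mx_morD.
by apply: (is_positiveD (@mcat_direct_sums _ _ M')); [exact: cpS pa|exact: cpT pa].
Qed.

Lemma comp_mult_cp (M'' : cstarModCat C) (m'' : M'') (T' : multiplier m' m'')
    (T : multiplier m m') : mult_cp T' -> mult_cp T -> mult_cp (comp_mult T' T).
Proof.
move=> cpT' cpT X n S v S'' v'' a dv dv'' pa.
have [S' [v' dv']] := mcat_direct_sums (fun _ : 'I_n => act m' X).
exact: (cpT' _ _ _ _ _ _ _ dv' dv'' (cpT _ _ _ _ _ _ _ dv dv' pa)).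
Qed.

(** Transported along the associativity of the action, a direct sum of copies of
    [m <| V <| X] becomes one of [m <| (V (x) X)], and a shifted multiplier acts
    on matrices as the original one does. *)
Lemma mx_mor_shift (V : C) (T : multiplier m m') (X Y : C) n
    (S : M) (v : 'I_n -> hom (act (act m V) X) S) (Q : M)
    (w : 'I_n -> hom (act (act m V) Y) Q)
    (S' : M') (v' : 'I_n -> hom (act (act m' V) X) S') (Q' : M')
    (w' : 'I_n -> hom (act (act m' V) Y) Q') a :
  mx_mor v' w' (fun i j => shift_mult V T X Y (a i j)) =
  mx_mor (fun i => castm (actA m' V X) erefl (v' i))
    (fun i => castm (actA m' V Y) erefl (w' i))
    (fun i j => T _ _ (castm (actA m V X) (actA m V Y) (a i j))).
Proof.
rewrite -(mx_mor_castm (actA m' V X) (actA m' V Y)).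
by apply: eq_mx_mor => i j; rewrite castmK.
Qed.

Lemma shift_mult_cp (V : C) (T : multiplier m m') :
  mult_cp T -> mult_cp (shift_mult V T).
Proof.
move=> cpT X n S v S' v' a dv dv' pa; rewrite (mx_mor_shift T v v).
move: pa; rewrite -(mx_mor_castm (actA m V X) (actA m V X)) => pa.
by apply: cpT pa; exact: direct_sum_castm.
Qed.

Lemma shift_mult_unital (V : C) (T : multiplier m m') :
  mult_unital T -> mult_unital (shift_mult V T).
Proof. by move=> uT X; rewrite /= castm_id uT castm_id. Qed.

Lemma shift_mult_completely_isometric (V : C) (T : multiplier m m') :
  completely_isometric T -> completely_isometric (shift_mult V T).
Proof.
move=> ciT X Y n S v Q w S' v' Q' w' a dv dw dv' dw'.
rewrite (mx_mor_shift T v w) -(mx_mor_castm (actA m V X) (actA m V Y) v w).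
by apply: ciT; exact: direct_sum_castm.
Qed.

End Operations.

Section Products.
Variables (L M N : cstarModCat C) (l : L) (m : M) (n : N).

Lemma fst_mult_cp : mult_cp (fst_mult m n).
Proof.
move=> X k S v S' v' a dv dv'; rewrite mx_mor_pair is_positive_pair => -[pa _].
by apply: id_mult_cp pa => //; have [] := (direct_sum_pair v).1 dv.
Qed.

Lemma snd_mult_cp : mult_cp (snd_mult m n).
Proof.
move=> X k S v S' v' a dv dv'; rewrite mx_mor_pair is_positive_pair => -[_ pa].
by apply: id_mult_cp pa => //; have [] := (direct_sum_pair v).1 dv.
Qed.

Lemma pair_mult_cp (S : multiplier l m) (T : multiplier l n) :
  mult_cp S -> mult_cp T -> mult_cp (pair_mult S T).
Proof.
move=> cpS cpT X k Q v Q' v' a dv dv' pa.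
have [dv1 dv2] := (direct_sum_pair v').1 dv'.
rewrite mx_mor_pair; apply/is_positive_pair; split.
  exact: cpS pa.
exact: cpT pa.
Qed.

Definition prod_mult (S : multiplier l m) :
    multiplier ((l, n) : prodMod L N) ((m, n) : prodMod M N) :=
  pair_mult (comp_mult S (fst_mult l n)) (snd_mult l n).

End Products.

Lemma prod_mult_ucp (L M N : cstarModCat C) (l : L) (m : M) (n : N)
    (S : multiplier l m) : mult_ucp S -> mult_ucp (prod_mult n S).
Proof.
move=> [uS cpS]; split; first by move=> X; rewrite /= uS.
apply: pair_mult_cp; last exact: snd_mult_cp.
by apply: comp_mult_cp => //; exact: fst_mult_cp.
Qed.

Lemma prod_mult_completely_isometric (L M N : cstarModCat C) (l : L) (m : M)
    (n : N) (S : multiplier l m) :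
  completely_isometric S -> completely_isometric (prod_mult n S).
Proof.
move=> ciS X Y k P v Q w P' v' Q' w' a.
move=> /direct_sum_pair[v1 v2] /direct_sum_pair[w1 w2].
move=> /direct_sum_pair[v'1 v'2] /direct_sum_pair[w'1 w'2].
rewrite !mx_mor_pair !prod_norm_max; congr Num.max; first exact: ciS.
exact: norm_mx_mor_eq.
Qed.

End Positivity.

(** * Direct summands of injective objects *)

Section Summand.
Variables (R : realType) (C : cstarTensorCat R) (M : cstarModCat C).

(** The second factor of the product source carries the complementary corner
    [w g w^*], which is exactly what is missing for [f |-> v Phi(f) v^*] to be
    unital; it disappears again after compression by [v]. *)
Lemma injective_summand (p q : M) :
  injective_pointed p -> direct_summand q p -> injective_pointed q.
Proof.
move=> injp [z [v [w [vI wI vw vvww]]]] N n N' n' Phi Psi [uPhi cpPhi] ucpPsi ciPsi.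
pose vPhi := conj_mult v^\adj (comp_mult Phi (fst_mult n z)).
pose wId := conj_mult w^\adj (snd_mult n z).
have ucpS : mult_ucp (add_mult vPhi wId).
  split.
    move=> X; rewrite /= uPhi !adjK !hcompm1 -!actm_hcomp hcompm1.
    by have := actm_linearl 1 (v \oc v^\adj) (w \oc w^\adj) (idm X);
      rewrite !scale1r vvww actm_id.
  apply: add_mult_cp; apply: conj_mult_cp; last exact: snd_mult_cp.
  by apply: comp_mult_cp => //; exact: fst_mult_cp.
have [T [[uT cpT] TPsi]] := injp _ _ _ _ _ (prod_mult z Psi) ucpS
  (prod_mult_ucp z ucpPsi) (prod_mult_completely_isometric (n := z) ciPsi).
pose Phi' := conj_mult v (comp_mult T
  (pair_mult (id_mult n') (zero_mult n' z))).
have Phi'E X Y (f : hom (act n X) (act n Y)) : Phi' X Y (Psi X Y f) = Phi X Y f.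
  rewrite /= [X in _ \oc X \oc _](TPsi X Y (f, 0)) /=.
  rewrite hcompm0 hcomp0m addr0 adjK !hcompA -actm_hcomp vI.
  by rewrite -hcompA -actm_hcomp vI !hcomp1m !actm_id hcomp1m hcompm1.
exists Phi'; split=> //; split.
  (* the identity is in the range of [Psi], where [Phi'] is already known *)
  by move=> X; rewrite -(uPhi X) -Phi'E ucpPsi.1.
apply: conj_mult_cp; apply: comp_mult_cp => //.
by apply: pair_mult_cp; [exact: id_mult_cp|exact: zero_mult_cp].
Qed.

End Summand.

(** * Conjugates and the action of an object *)

Section Conjugates.
Variables (R : realType) (C : cstarTensorCat R).

Lemma tensmZl (X X' Y Y' : C) (a : R[i]) (f : hom X X') (g : hom Y Y') :
  tensm (a *: f) g = a *: tensm f g.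
Proof.
exact: (linearZ_LR (linear_of (fun a f f' => tensm_linearl a f f' g))).
Qed.

Lemma tensmZr (X X' Y Y' : C) (a : R[i]) (f : hom X X') (g : hom Y Y') :
  tensm f (a *: g) = a *: tensm f g.
Proof.
exact: (linearZ_LR (linear_of (fun a g g' => tensm_linearr a f g g'))).
Qed.

Lemma castmZ (X Y X' Y' : C) (eX : X = X') (eY : Y = Y') (a : R[i])
    (f : hom X Y) : castm eX eY (a *: f) = a *: castm eX eY f.
Proof. exact: (linearZ_LR (linear_of (castm_linear eX eY))). Qed.

(** As the unit object is simple, [rb^* rb] is a scalar [|a|^2]. If it vanishes
    then so does [rb], and the conjugate equation forces [U] to be a zero object.
    Otherwise dividing [rb] by [a] makes it an isometry, and multiplying [r] by
    the conjugate of [a] preserves the conjugate equation, where [rb] occurs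
    through its adjoint. Positivity of the scalar is read off from a factorization
    [rb^* rb = g^* g] with [g] an endomorphism of the unit, hence itself a
    scalar. *)
Lemma isometric_conjugate (U : C) : rigid C ->
  idm U = 0 \/
  exists (V : C) (r : hom tunit (tens V U)) (rb : hom tunit (tens U V)),
    isometry rb /\
    castm erefl (tens1X U) (tensm rb^\adj (idm U))
      \oc castm (tensX1 U) (esym (tensA U V U)) (tensm (idm U) r) = idm U.
Proof.
move=> /(_ U)[V [r [rb [conj_eq _]]]].
have [g rbE] := adj_hcomp_pos rb; have [a gE] := tunit_simple g.
have {}rbE : rb^\adj \oc rb = (Num.conj a * a) *: idm tunit.
  by rewrite rbE gE adj_scale hcompZl hcompZr adj_id hcomp1m scalerA.
have [a0|a0] := eqVneq a 0.
  left; have rb0 : rb = 0.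
    apply/eqP; have : `|rb| ^+ 2 = 0.
      by rewrite -cstar_norm rbE a0 mulr0 scale0r normr0.
    by move/eqP; rewrite expf_eq0 normr_eq0.
  by rewrite -conj_eq rb0 adj0 -(scale0r 0) tensmZl castmZ scale0r hcomp0m.
right; exists V, (Num.conj a *: r), (a^-1 *: rb); split.
  rewrite /isometry adj_scale hcompZl hcompZr rbE !scalerA fmorphV.
  by rewrite mulrACA mulVf ?conjC_eq0 // mulVf // mulr1 scale1r.
rewrite adj_scale tensmZl tensmZr !castmZ hcompZl hcompZr scalerA conj_eq fmorphV.
by rewrite mulVf ?conjC_eq0 // scale1r.
Qed.

End Conjugates.

Section Induction.
Variables (R : realType) (C : cstarTensorCat R).

(** With [r] part of a solution of the conjugate equations, this is the unit of
    the adjunction between the actions of [A] and of [B]. *)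
Definition act_unit (M : cstarModCat C) (m : M) (A B : C)
    (r : hom tunit (tens A B)) : hom m (act (act m A) B) :=
  castm (act1 m) (esym (actA m A B)) (actm (idm m) r).

Lemma heq_act_unit (M : cstarModCat C) (m : M) (A B : C)
  (r : hom tunit (tens A B)) : heq (act_unit m r) (actm (idm m) r).
Proof. exact: heq_castm. Qed.

Lemma act_unit_isometry (M : cstarModCat C) (m : M) (A B : C)
  (r : hom tunit (tens A B)) : isometry r -> isometry (act_unit m r).
Proof.
move=> rI; apply: heq_eq.
apply: heq_trans (heq_hcomp (heq_adj (heq_act_unit _ _)) (heq_act_unit _ _)) _.
by rewrite actm_adj -actm_hcomp rI adj_id hcomp1m; exact: heq_actm1.
Qed.

Lemma heq_act_unit_actm (M : cstarModCat C) (m : M) (A B X : C)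
    (r : hom tunit (tens A B)) :
  heq (actm (act_unit m r) (idm X)) (actm (idm m) (tensm r (idm X))).
Proof.
apply: heq_trans (heq_actmA _ _ _).
by apply: heq_actm; [exact: heq_act_unit|exact: heq_refl].
Qed.

Lemma heq_act_unit_adj_actm (M : cstarModCat C) (m : M) (A B X : C)
    (r : hom tunit (tens A B)) :
  heq (actm (act_unit m r)^\adj (idm X)) (actm (idm m) (tensm r^\adj (idm X))).
Proof.
have := heq_adj (heq_act_unit_actm m X r).
by rewrite !actm_adj tensm_adj !adj_id.
Qed.

Section Shift.
Variables (M M' : cstarModCat C) (m : M) (m' : M') (T : multiplier m m').

Lemma heq_shift_mult (V X Y X' Y' : C)
    (f : hom (act (act m V) X) (act (act m V) Y))
    (f' : hom (act m X') (act m Y')) :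
  tens V X = X' -> tens V Y = Y' -> heq f f' ->
  heq (shift_mult V T X Y f) (T X' Y' f').
Proof.
move=> eX eY ff'; apply: heq_trans (heq_castm _ _ _) _.
by apply: heq_mult => //; exact: heq_trans (heq_castm _ _ _) ff'.
Qed.

End Shift.

Section ShiftUnit.
Variables (M M' : cstarModCat C) (m : M) (m' : M') (T : multiplier m m').

(** Conjugation by [act_unit r] is [id <| (r (x) id)] on both sides, so this is
    bimodularity of [T] once [f] is seen as a morphism between [m <| (1 (x) X)]
    and [m <| (1 (x) Y)]. *)
Lemma shift_mult_unit (V U X Y : C) (r : hom tunit (tens V U))
    (f : hom (act m X) (act m Y)) :
  shift_mult U (shift_mult V T) X Y
    (actm (act_unit m r) (idm Y) \oc f \oc actm (act_unit m r)^\adj (idm X)) =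
  actm (act_unit m' r) (idm Y) \oc T X Y f
    \oc actm (act_unit m' r)^\adj (idm X).
Proof.
pose f1 : hom (act m (tens tunit X)) (act m (tens tunit Y)) :=
  castm (congr1 (act m) (esym (tens1X X))) (congr1 (act m) (esym (tens1X Y))) f.
pose g := actm (idm m) (tensm r (idm Y)) \oc f1
  \oc actm (idm m) (tensm r^\adj (idm X)).
apply: heq_eq; apply: (@heq_trans _ _ _ _ _ _ _ _ _ (T _ _ g)).
  apply: (@heq_trans _ _ _ _ _ _ _ _ _
    (shift_mult V T (tens U X) (tens U Y)
      (castm (actA _ U X) (actA _ U Y)
       (actm (act_unit m r) (idm Y) \oc f
         \oc actm (act_unit m r)^\adj (idm X))))).
    by apply: heq_shift_mult => //; exact/heq_sym/heq_castm.
  apply: heq_shift_mult; rewrite ?tensA //.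
  apply: heq_trans (heq_castm _ _ _) _.
  apply: heq_hcomp; last exact: heq_act_unit_adj_actm.
  by apply: heq_hcomp; [exact: heq_act_unit_actm|exact/heq_sym/heq_castm].
rewrite mult_bimod; apply/heq_sym.
apply: heq_hcomp; last exact: heq_act_unit_adj_actm.
apply: heq_hcomp; first exact: heq_act_unit_actm.
by apply: heq_mult; rewrite ?tens1X //; exact/heq_sym/heq_castm.
Qed.

Lemma shift_mult_comp (M'' : cstarModCat C) (m'' : M'')
    (T' : multiplier m' m'') (V X Y : C)
    (f : hom (act (act m V) X) (act (act m V) Y)) :
  shift_mult V T' X Y (shift_mult V T X Y f) =
  shift_mult V (comp_mult T' T) X Y f.
Proof. by rewrite /= castmK. Qed.

Lemma shift_conj_mult (U X Y : C) (m'' : M') (t : hom m'' m')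
    (f : hom (act (act m U) X) (act (act m U) Y)) :
  shift_mult U (conj_mult t T) X Y f =
  actm (actm t (idm U))^\adj (idm Y) \oc shift_mult U T X Y f
    \oc actm (actm t (idm U)) (idm X).
Proof.
apply: heq_eq; apply: heq_trans (heq_castm _ _ _) _.
apply: heq_hcomp; last exact/heq_sym/heq_actm_idm_idr.
apply: heq_hcomp; last exact/heq_sym/heq_castm.
by rewrite actm_adj adj_id; exact/heq_sym/heq_actm_idm_idr.
Qed.

End ShiftUnit.

(** The two factors are [id_m <| (rb^* (x) id_U)] and [id_m <| (id_U (x) r)], so
    this is the conjugate equation acted on by [m]. *)
Lemma act_conjugate (M : cstarModCat C) (m : M) (U V : C)
    (r : hom tunit (tens V U)) (rb : hom tunit (tens U V)) :
  castm erefl (tens1X U) (tensm rb^\adj (idm U))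
    \oc castm (tensX1 U) (esym (tensA U V U)) (tensm (idm U) r) = idm U ->
  (actm (act_unit m rb) (idm U))^\adj \oc act_unit (act m U) r =
  idm (act m U).
Proof.
move=> conj_eq.
rewrite -[RHS]actm_id -[in RHS]conj_eq -(hcomp1m (idm m)) actm_hcomp.
apply: heq_eq; apply: heq_hcomp.
  rewrite actm_adj adj_id; apply: heq_trans (heq_act_unit_adj_actm _ _ _) _.
  by apply: heq_actm; [exact: heq_refl|exact/heq_sym/heq_castm].
apply: heq_trans (heq_act_unit _ _) _; rewrite -actm_id.
apply: heq_trans (heq_actmA _ _ _) _.
by apply: heq_actm; [exact: heq_refl|exact/heq_sym/heq_castm].
Qed.

Lemma injective_zero (M : cstarModCat C) (p : M) :
  idm p = 0 -> injective_pointed p.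
Proof.
move=> p0 N n N' n' Phi Psi _ _ _; exists (zero_mult n' p).
have id0 X : idm (act p X) = 0.
  rewrite -actm_id p0.
  exact: (linear0 (linear_of (fun a f f' => actm_linearl a f f' (idm X)))).
split=> [|X Y f]; first by split=> [X|]; [rewrite id0|exact: zero_mult_cp].
by rewrite -[RHS]hcomp1m id0 hcomp0m.
Qed.

(** The extension is sought for the Frobenius transpose [theta0] of [Phi], whose
    values lie in [(M, m)], and then transposed back. *)
Lemma injective_act (M : cstarModCat C) (m : M) (U : C) :
  rigid C -> injective_pointed m -> injective_pointed (act m U).
Proof.
move=> rigidC injm.
have [U0|[V [r [rb [rbI conj_eq]]]]] := isometric_conjugate U rigidC.
  apply: injective_zero; rewrite -actm_id U0.
  exact: (linear0 (linear_of (fun a g g' => actm_linearr a (idm m) g g'))).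
move=> N n N' n' Phi Psi [uPhi cpPhi] [uPsi cpPsi] ciPsi.
pose theta0 := conj_mult (act_unit m rb) (shift_mult V Phi).
have ucptheta0 : mult_ucp theta0.
  split; last by apply/conj_mult_cp/shift_mult_cp.
  move=> X; rewrite /= castm_id uPhi castm_id hcompm1 -actm_hcomp.
  by rewrite act_unit_isometry // hcomp1m actm_id.
have [theta [[_ cptheta] thetaPsi]] := injm _ _ _ _ theta0 (shift_mult V Psi)
  ucptheta0 (conj (shift_mult_unital V uPsi) (shift_mult_cp (V := V) cpPsi))
  (shift_mult_completely_isometric (V := V) ciPsi).
pose Phi' := comp_mult (shift_mult U theta)
  (conj_mult (act_unit n' r)^\adj (id_mult n')).
have Phi'E X Y (f : hom (act n X) (act n Y)) : Phi' X Y (Psi X Y f) = Phi X Y f.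
  pose g := actm (act_unit n r) (idm Y) \oc f
    \oc actm (act_unit n r)^\adj (idm X).
  transitivity (shift_mult U theta X Y (shift_mult U (shift_mult V Psi) X Y g)).
    by rewrite shift_mult_unit /= adjK.
  transitivity (shift_mult U theta0 X Y g).
    by rewrite shift_mult_comp; congr castm; exact: thetaPsi.
  rewrite shift_conj_mult shift_mult_unit !hcompA -actm_hcomp act_conjugate //.
  rewrite -!hcompA -actm_hcomp !hcomp1m actm_id hcomp1m.
  rewrite -[X in actm X _](adjK) adj_hcomp adjK act_conjugate //.
  by rewrite adj_id actm_id hcompm1.
exists Phi'; split=> //; split.
  by move=> X; rewrite -uPsi Phi'E uPhi.
by apply: comp_mult_cp; [exact: shift_mult_cp|exact/conj_mult_cp/id_mult_cp].
Qed.

End Induction.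

Theorem proposition4p8 (R : realType) (C : cstarTensorCat R)
    (rigidC : rigid C) (M : cstarModCat C) (m : M)
    (injMm : injective_pointed m) (U : C) (m' : M)
    (summand : direct_summand m' (act m U)) :
  injective_pointed m'.
Proof. exact (injective_summand (injective_act rigidC injMm) summand). Qed.
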